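(* The cycle index of the $3$-group $S_7^{(3)}$ of the symmetric group $S_7$, i.e. of the action of $S_7$ on the $35$ three-element subsets of $\{1,\dots,7\}$, in the variables $a_1,a_2,\dots$, is \begin{align*} Z(S_7^{(3)}) = \frac{1}{7!} \big(& a_{1}^{35} + 21 a_{1}^{15} a_{2}^{10} + 105 a_{1}^{7} a_{2}^{14} + 70 a_{1}^{5} a_{3}^{10} + 105 a_{1}^{3} a_{2}^{16} \\ & + 420 a_{1}^{3} a_{2} a_{3}^{4} a_{6}^{3} + 280 a_{1}^{2} a_{3}^{11} + 420 a_{1} a_{4} a_{6} a_{12}^{2} + 840 a_{1} a_{2}^{3} a_{4}^{7} \\ & + 210 a_{1} a_{2}^{2} a_{3}^{2} a_{6}^{4} + 504 a_{5}^{3} a_{10}^{2} + 840 a_{2} a_{3} a_{6}^{5} + 504 a_{5}^{7} + 720 a_{7}^{5}\big). \end{align*}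
   Context: For a permutation group $A$ on a finite set, and $\alpha\in A$, let $j_k(\alpha)$ be the number of cycles of length $k$ in the disjoint cycle decomposition of $\alpha$ (fixed points counted as cycles of length $1$). The cycle index of $A$ is the polynomial $Z(A)=\frac{1}{|A|}\sum_{\alpha\in A}\prod_{k} a_k^{j_k(\alpha)}$ in the variables $a_1,a_2,\dots$ with rational coefficients. For $1\le r\le p$, $S_p^{(r)}$ (the $r$-group of $S_p$) is the permutation group on the set of $r$-element subsets of $\{1,\dots,p\}$ formed by the permutations $\alpha'$ induced by $\alpha\in S_p$ via $\alpha'\{i_1,\dots,i_r\}=\{\alpha i_1,\dots,\alpha i_r\}$. *)

(* Defs.v *)
From HB Require Import structures.
From mathcomp Require Import all_boot all_order all_algebra all_fingroup.
From mathcomp Require Export monalg.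

Set Implicit Arguments.
Unset Strict Implicit.
Unset Printing Implicit Defensive.

Import GRing.Theory.
Local Open Scope ring_scope.

(* Rational polynomials in countably many commuting variables, indexed by nat;
   only the variables a_k with k >= 1 occur in a cycle index. *)
Definition cpoly := {malg rat[{cmonom nat}]}.
HB.instance Definition _ := GRing.ComAlgebra.on cpoly.

Definition a (k : nat) : cpoly := << ucm k >>.

(* [porbits s] is the set of all cycles of [s], fixed points included as
   singletons. *)
Definition ncycles (T : finType) (k : nat) (s : {perm T}) : nat :=
  #|[set c in porbits s | #|c| == k]|.

(* A cycle has at least 1 and at most #|T| elements, so all other k would
   contribute a factor 1. *)
Definition cycle_index (T : finType) (A : {group {perm T}}) : cpoly :=
  (#|A|%:R : rat)^-1 *:
    \sum_(s in A) \prod_(1 <= k < #|T|.+1) a k ^+ ncycles k s.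

Section RGroup.

Variables p r : nat.

(* 'I_p = {0, ..., p - 1} stands for {1, ..., p}. *)
Definition rsubset := {A : {set 'I_p} | #|A| == r}.
HB.instance Definition _ := Finite.on rsubset.

Lemma card_imset_perm (s : {perm 'I_p}) (A : rsubset) :
  #|s @: val A| == r.
Proof. by rewrite (card_imset _ perm_inj) (valP A). Qed.

Definition rimage (s : {perm 'I_p}) (A : rsubset) : rsubset :=
  exist _ (s @: val A) (card_imset_perm s A).

Lemma rimage_inj (s : {perm 'I_p}) : injective (rimage s).
Proof. by move=> A B /(congr1 val) /(imset_inj perm_inj) /val_inj. Qed.

Definition rperm (s : {perm 'I_p}) : {perm rsubset} := perm (@rimage_inj s).

Lemma rpermM : {morph rperm : s t / (s * t)%g}.
Proof.
move=> s t; apply/permP => A; apply/val_inj.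
rewrite permM !permE /= -imset_comp.
by apply: eq_imset => i; rewrite /= permM.
Qed.

Definition rgroup_set : {set {perm rsubset}} := [set rperm s | s : {perm 'I_p}].

Lemma rgroup_group_set : group_set rgroup_set.
Proof.
apply/group_setP; split=> [|_ _ /imsetP[s _ ->] /imsetP[t _ ->]].
  apply/imsetP; exists 1%g => //; apply: (mulgI (rperm 1)).
  by rewrite -rpermM !mulg1.
by apply/imsetP; exists (s * t)%g; rewrite ?rpermM.
Qed.

Definition rgroup : {group {perm rsubset}} := group rgroup_group_set.

End RGroup.

(* Main.v *)
Require Import Defs.
From mathcomp Require Import all_boot all_order all_algebra all_fingroup.
From mathcomp Require Import zify ring.
Local Open Scope ring_scope.

Set Implicit Arguments.
Unset Strict Implicit.
Unset Printing Implicit Defensive.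
Import GRing.Theory.

(* S_7 acts faithfully on 3-subsets, so the cycle index is a sum over the 5040
   permutations of S_7. The monomial of a permutation depends only on its cycle
   type: listing its cycles by decreasing length conjugates it to a standard
   permutation. All 5040 one-line notations are sorted by cycle type by
   computation, and the cycles on the 35 subsets, encoded as indicator words of
   length 7 and weight 3, are computed for the 15 standard permutations. *)

(** * From cycle counts to products over cycles *)

Lemma prod_ncycles (T : finType) (s : {perm T}) (n : nat) : (#|T| <= n)%N ->
  \prod_(1 <= k < n.+1) a k ^+ ncycles k s = \prod_(c in porbits s) a #|c|.
Proof.
move=> leTn.
have szc (c : {set T}) : c \in porbits s -> (0 < #|c| < n.+1)%N.
  case/imsetP=> x _ ->; rewrite lt0n card_porbit_neq0 ltnS.
  exact: leq_trans (max_card _) leTn.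
rewrite big_add1 /= big_mkord.
(* [inord] needs a successor bound, so the lengths, lowered by one, fall into [n.+1] classes; the
   top class is empty since no cycle is longer than [n]. *)
rewrite (partition_big (fun c : {set T} => inord #|c|.-1 : 'I_n.+1) xpredT) //=.
rewrite big_ord_recr /= [X in _ = _ * X]big1 ?mulr1; last first.
  move=> c /andP[/szc /andP[c0 cT]] /eqP/(congr1 val) /=.
  rewrite inordK; last by rewrite (leq_trans _ cT) // ltnS leq_pred.
  by move=> e; exfalso; move: c0 cT e; lia.
apply: eq_bigr => k _; rewrite /ncycles -prodr_const.
apply: eq_big => [c|c]; last by rewrite inE => /andP[_ /eqP ->].
rewrite inE; apply: andb_id2l => /szc /andP[c0 cT].
rewrite -val_eqE /= inordK; last by rewrite (leq_trans _ cT) // ltnS leq_pred.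
by rewrite -{1}(prednK c0) eqSS.
Qed.

(** * Transfer of cycles along an equivariant injection *)

Section CycleModel.

Variables (T : finType) (X : eqType) (s : {perm T}) (f : X -> X) (h : T -> X).
Hypotheses (h_inj : injective h) (hs : forall x, h (s x) = f (h x)).

Let hX n x : h ((s ^+ n)%g x) = iter n f (h x).
Proof. by rewrite permX; elim: n => //= n <-; rewrite hs. Qed.

Lemma porbit_model (c : seq X) (x : T) :
  fcycle f c -> h x \in c -> porbit s x = [set y | h y \in c].
Proof.
move=> fc xc; apply/setP => y; rewrite inE; apply/porbitP/idP => [[n ->]|yc].
  rewrite hX; elim: n => //= n IH.
  by rewrite (eqP (next_cycle fc IH)) mem_next.
(* Rotated to start at [h x], the list [c] is a trajectory of [f], so each of its entries is an
   iterate of [h x]. *)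
have [i p cE] := rot_to xc.
move: fc yc; rewrite -(rot_cycle i) -(mem_rot i) cE /=.
rewrite rcons_path => /andP[/fpathP[n ->] _] yc.
have /trajectP[j _ yj] : h y \in traject f (h x) n.+1 by [].
by exists j; apply: h_inj; rewrite hX.
Qed.

(** Since [h] is injective, [flatten L] has no duplicates; hence the preimages of the lists in [L]
    are the cycles of [s], each met once. *)
Lemma prod_porbits_model (R : comNzRingType) (F : nat -> R) (L : seq (seq X)) :
  all (fcycle f) L -> [::] \notin L -> perm_eq (flatten L) (codom h) ->
  \prod_(c in porbits s) F #|c| = \prod_(c <- L) F (size c).
Proof.
move=> /allP fL L0 hL; pose pre (c : seq X) := [set x | h x \in c].
have codomP c y : c \in L -> y \in c -> exists x, y = h x.
  move=> cL yc; have /codomP[x ->] : y \in codom h; last by exists x.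
  by rewrite -(perm_mem hL); apply/flattenP; exists c.
have uL : uniq (flatten L).
  by rewrite (perm_uniq hL) map_inj_uniq ?enum_uniq.
have card_pre c : c \in L -> uniq c -> #|pre c| = size c.
  move=> cL uc; rewrite cardE -(size_map h); apply/perm_size/uniq_perm => //.
    by rewrite map_inj_uniq ?enum_uniq.
  move=> y; apply/mapP/idP => [[x]|yc]; first by rewrite mem_enum inE => ? ->.
  by have [x yE] := codomP c y cL yc; exists x; rewrite // mem_enum inE -yE.
have uniqL c : c \in L -> uniq c.
  move=> cL; elim: L uL cL {fL L0 hL codomP card_pre} => //= d L IH.
  rewrite cat_uniq inE => /and3P[ud _ uL] /predU1P[-> //|]; exact: IH.
have upre : uniq (map pre L).
  (* The induction runs over a sublist, so that [codomP] stays available for all of [L]. A nonempty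
     head with the same preimage as a later list would share an entry with it. *)
  have: {subset L <= L} by [].
  move: uL L0; elim: {1 2 3 5}L => //= c L' IH; rewrite cat_uniq inE.
  case/and3P=> _ /hasPn cL' uL' /norP[c0 L'0] sL.
  rewrite {}IH // ?andbT; last by move=> d dL; rewrite sL // inE dL orbT.
  apply/negP => /mapP[d dL' /setP ecd].
  case: c c0 cL' sL ecd => // y c _ cL' sL ecd.
  have [x yE] := codomP _ y (sL _ (mem_head _ _)) (mem_head _ _).
  have := ecd x; rewrite !inE -yE eqxx /= => /esym yd.
  have /cL' : y \in flatten L' by apply/flattenP; exists d.
  by rewrite inE eqxx.
rewrite -big_enum /= (@perm_big _ _ _ _ _ (map pre L)) /=; last first.
  apply: uniq_perm; rewrite ?enum_uniq // => C; rewrite mem_enum.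
  apply/imsetP/mapP => [[x _ ->]|[c cL ->]].
    have : h x \in flatten L by rewrite (perm_mem hL) codom_f.
    by case/flattenP=> c cL xc; exists c; rewrite // (porbit_model (fL c cL)).
  case: c cL => [|y c] cL; first by rewrite cL in L0.
  have [x yE] := codomP _ y cL (mem_head _ _); exists x => //.
  by rewrite (porbit_model (fL _ cL)) // -yE mem_head.
rewrite big_map big_seq [RHS]big_seq.
by apply: eq_bigr => c cL; rewrite card_pre ?uniqL.
Qed.

End CycleModel.

(** If [s x] and [t x] differ, take a subset containing [x] but not the point [y] that [t] sends to
    [s x]: its image under [s] contains [s x], its image under [t] does not. The bound [r < p]
    leaves room to avoid [y]. *)
Lemma rperm_inj (p r : nat) : (0 < r < p)%N -> injective (@rperm p r).
Proof.
case: r => // r /= lt_rp s t est; apply/permP => x.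
apply/eqP/negPn/negP => neq_stx.
pose y := (t^-1)%g (s x).
have neq_yx : y != x by apply: contraNneq neq_stx => yx; rewrite -{2}yx permKV.
pose B := [set z in take r (enum (~: [set x; y]))].
have cB : #|B| = r.
  rewrite cardsE (card_uniqP _) ?take_uniq ?enum_uniq // size_takel // -cardE.
  have := cardsC [set x; y]; rewrite cards2 eq_sym neq_yx card_ord; lia.
have BC z : z \in B -> z \notin [set x; y].
  by rewrite inE => /mem_take; rewrite mem_enum inE.
have cA : #|x |: B| == r.+1.
  rewrite cardsU1 cB; case: (boolP (x \in B)) => // /BC.
  by rewrite !inE eqxx.
pose A : rsubset p r.+1 := exist _ (x |: B) cA.
have /(congr1 (fun u : {perm rsubset p r.+1} => val (u A))) := est.
rewrite /rperm !permE /= => /setP /(_ (s x)).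
rewrite mem_imset ?setU11; last exact: perm_inj.
rewrite -[s x in RHS](permKV t) -/y mem_imset; last exact: perm_inj.
rewrite in_setU1 (negbTE neq_yx) /= => /esym/BC.
by rewrite !inE eqxx orbT.
Qed.

(** Faithfulness moves the sum to ['S_p]. It is reindexed by inverses because reading an indicator
    word along the one-line notation of [s] describes a preimage under [s]. *)
Lemma cycle_index_rgroup (p r : nat) : (0 < r < p)%N ->
  cycle_index (rgroup p r) =
  (p`!%:R : rat)^-1 *:
    \sum_(s : 'S_p) \prod_(c in porbits (rperm r s^-1)) a #|c|.
Proof.
move=> /rperm_inj inj.
have cA : #|rgroup p r| = p`!.
  by rewrite /= /rgroup_set card_imset; [exact: card_Sn | exact: inj].
rewrite /cycle_index cA; congr (_ *: _).
rewrite big_imset /=; last by move=> s t _ _; apply: inj.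
rewrite (reindex_inj invg_inj) /=.
by apply: eq_big => [s|s _]; rewrite ?inE // prod_ncycles.
Qed.

(** * Permutations in one-line notation *)

Definition oneline (n : nat) (s : 'S_n) : seq nat := [seq val (s i) | i <- enum 'I_n].

Lemma nth_oneline (n : nat) (s : 'S_n) (i : 'I_n) : nth 0%N (oneline s) i = s i.
Proof. by rewrite (nth_map i) ?size_enum_ord // nth_ord_enum. Qed.

Lemma oneline_inj (n : nat) : injective (@oneline n).
Proof.
by move=> s t est; apply/permP => i; apply: val_inj; rewrite /= -!nth_oneline est.
Qed.

Lemma perm_oneline (n : nat) (s : 'S_n) : perm_eq (oneline s) (iota 0 n).
Proof.
rewrite /oneline map_comp -val_enum_ord perm_map //; apply: uniq_perm.
- by rewrite map_inj_uniq ?enum_uniq //; apply: perm_inj.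
- exact: enum_uniq.
by move=> i; rewrite mem_enum -[i](permKV s) mem_map ?mem_enum //; apply: perm_inj.
Qed.

Lemma sum_oneline (V : nmodType) (n : nat) (F : seq nat -> V) :
  \sum_(s : 'S_n) F (oneline s) = \sum_(l <- permutations (iota 0 n)) F l.
Proof.
rewrite -big_enum -(big_map (@oneline n) xpredT) /=; apply/perm_big/uniq_perm.
- by rewrite map_inj_uniq ?enum_uniq //; apply: oneline_inj.
- exact: permutations_uniq.
(* One inclusion suffices: both lists have [n]! entries, and the one-line notations are distinct. *)
have [|||_ eqS x //] := @uniq_min_size _ [seq oneline s | s <- enum {perm 'I_n}]
  (permutations (iota 0 n)).
- by rewrite map_inj_uniq ?enum_uniq //; apply: oneline_inj.
- by move=> _ /mapP[s _ ->]; rewrite mem_permutations perm_oneline.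
by rewrite size_permutations ?iota_uniq // size_iota size_map -cardE card_Sn.
Qed.

(* If b is the indicator word of A and l the one-line notation of s, then
   act l b is the indicator word of the preimage of A under s. *)
Definition act (l : seq nat) (b : bitseq) : bitseq := [seq nth false b i | i <- l].

Definition indicator (p r : nat) (A : rsubset p r) : bitseq :=
  [seq i \in val A | i <- enum 'I_p].

Definition weight_words (p r : nat) : seq bitseq :=
  permutations (nseq r true ++ nseq (p - r) false).

(** * Subsets as binary words *)

Section Indicator.

Variables p r : nat.
Implicit Types (A : rsubset p r) (s : 'S_p) (l w t : seq nat).

Lemma size_indicator A : size (indicator A) = p.
Proof. by rewrite size_map size_enum_ord. Qed.

Lemma nth_indicator A (i : 'I_p) : nth false (indicator A) i = (i \in val A).
Proof. by rewrite (nth_map i) ?size_enum_ord // nth_ord_enum. Qed.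

Lemma indicator_inj : injective (@indicator p r).
Proof.
by move=> A B eAB; apply/val_inj/setP => i; rewrite -!nth_indicator eAB.
Qed.

Lemma indicator_rperm s A : indicator (rperm r s^-1 A) = act (oneline s) (indicator A).
Proof.
rewrite /act /oneline -map_comp; apply: eq_map => i /=.
rewrite nth_indicator permE /= -{1}[i](permK s) mem_imset //; exact: perm_inj.
Qed.

Lemma act_act l w b : all (gtn (size l)) w ->
  act w (act l b) = act [seq nth 0%N l i | i <- w] b.
Proof.
move/allP=> wl; rewrite /act -map_comp; apply/eq_in_map => i /wl /= il.
by rewrite (nth_map 0%N).
Qed.

Lemma act_indicator_inj w : perm_eq w (iota 0 p) ->
  injective (fun A => act w (indicator A)).
Proof.
move=> wp A B eAB; apply: indicator_inj.
apply: (@eq_from_nth _ false) => [|i]; rewrite !size_indicator // => ip.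
have iw : i \in w by rewrite (perm_mem wp) mem_iota.
have := congr1 (fun b => nth false b (index i w)) eAB.
by rewrite /act !(nth_map 0%N) ?index_mem // nth_index.
Qed.

Lemma act_indicator_weight w A : perm_eq w (iota 0 p) ->
  act w (indicator A) \in weight_words p r.
Proof.
move=> wp; rewrite mem_permutations.
have /permPl -> : perm_eq (act w (indicator A)) (indicator A).
  rewrite (permPl (perm_map _ wp)) -{2}(size_indicator A).
  by rewrite [X in perm_eq X _](mkseq_nth false).
have cT : count_mem true (indicator A) = r.
  rewrite count_map -[RHS](eqP (valP A)) cardE -size_filter /= enumT.
  by congr size; apply: eq_filter => i /=; rewrite eqb_id.
have szA := size_indicator A.
have cF := count_predC (pred1 true) (indicator A).
rewrite (@eq_count _ (predC (pred1 true)) (pred1 false)) in cF; last by case.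
apply/allP => -[] _ /=;
  rewrite count_cat !count_nseq /= ?mul1n ?mul0n ?addn0 ?add0n ?cT //.
by apply/eqP; rewrite -[p in RHS]szA -cF cT addKn.
Qed.

Lemma perm_codom_act w : perm_eq w (iota 0 p) ->
  size (weight_words p r) = 'C(p, r) ->
  perm_eq (codom (fun A => act w (indicator A))) (weight_words p r).
Proof.
move=> wp szW; have inj := act_indicator_inj wp.
have uC : uniq (codom (fun A => act w (indicator A))).
  by rewrite map_inj_uniq ?enum_uniq.
apply: uniq_perm => //; first exact: permutations_uniq.
have [||_ eqC x //] := uniq_min_size uC (s2 := weight_words p r).
  by move=> _ /codomP[A ->]; apply: act_indicator_weight.
rewrite szW size_codom card_sig.
by rewrite -[p in 'C(p, _)]card_ord -card_draws cardsE.
Qed.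

(* The hypothesis relating w and t says that relabelling the points by w
   turns s into the permutation with one-line notation t; hence the cycles on
   r-subsets need to be computed once per conjugacy class only. *)
Lemma prod_porbits_rperm (F : nat -> cpoly) s w t (M : seq (seq bitseq)) :
  perm_eq w (iota 0 p) -> all (gtn p) t ->
  [seq nth 0%N (oneline s) i | i <- w] = [seq nth 0%N w j | j <- t] ->
  size (weight_words p r) = 'C(p, r) ->
  all (fcycle (act t)) M -> [::] \notin M ->
  perm_eq (flatten M) (weight_words p r) ->
  \prod_(c in porbits (rperm r s^-1)) F #|c| = \prod_(c <- M) F (size c).
Proof.
move=> wp tp swt szW fM M0 pM.
have szw : size w = p by rewrite (perm_size wp) size_iota.
apply: (prod_porbits_model (act_indicator_inj wp) (f := act t)) => //; last first.
  by rewrite (permPl pM) perm_sym perm_codom_act.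
(* By [act_act], both sides read the indicator word of [A] along a composite list, and [swt] equates
   the two composites. *)
move=> A; rewrite indicator_rperm !act_act ?swt ?szw //.
rewrite size_map size_enum_ord.
by apply/allP => i; rewrite (perm_mem wp) mem_iota.
Qed.

End Indicator.

(* n and m are fuel: they bound the length and the number of the cycles. *)
Fixpoint cycles_rec (X : eqType) (f : X -> X) (n m : nat) (xs : seq X) : seq (seq X) :=
  if m is m'.+1 then
    if xs is x :: _ then
      let c := traject f x (find (pred1 x) (traject f (f x) n)).+1 in
      c :: cycles_rec f n m' [seq y <- xs | y \notin c]
    else [::]
  else [::].

Definition cycles (X : eqType) (f : X -> X) (xs : seq X) : seq (seq X) :=
  cycles_rec f (size xs) (size xs) xs.

Definition sorted_cycles (l : seq nat) : seq (seq nat) :=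
  sort (fun c d => size d <= size c)%N (cycles (nth 0%N l) (iota 0 (size l))).

Definition cycle_type (l : seq nat) : seq nat := map size (sorted_cycles l).

(* One-line notation: rot 1 turns a block of consecutive integers into the list
   of its images under the cycle formed by that block. *)
Definition standard_perm (mu : seq nat) : seq nat :=
  flatten [seq rot 1 c | c <- reshape mu (iota 0 (sumn mu))].

Definition word_cycles (p r : nat) (mu : seq nat) : seq (seq bitseq) :=
  cycles (act (standard_perm mu)) (weight_words p r).

(** A certificate: these booleans are hypotheses of [prod_porbits_rperm], so the output of [cycles]
    is validated by evaluation. *)
Definition standardizes (l : seq nat) : bool :=
  let w := flatten (sorted_cycles l) in
  perm_eq w (iota 0 (size l)) &&
  ([seq nth 0%N l i | i <- w] ==
   [seq nth 0%N w j | j <- standard_perm (cycle_type l)]).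

Definition word_cycles_ok (p r : nat) (mu : seq nat) : bool :=
  let f := act (standard_perm mu) in
  let M := word_cycles p r mu in
  [&& all (gtn p) (standard_perm mu), all (fcycle f) M, [::] \notin M
    & perm_eq (flatten M) (weight_words p r)].

(** * Computation for the symmetric group on 7 points *)

Definition S7 : seq (seq nat) := permutations (iota 0 7).

Lemma S7_standardizes : all standardizes S7.
Proof. by vm_compute. Qed.

Lemma S7_word_cycles_ok :
  all (word_cycles_ok 7 3) (unzip1 (tally [seq cycle_type l | l <- S7])).
Proof. by vm_compute. Qed.

(** Each entry pairs the cycle lengths on 3-subsets with the size of a conjugacy class. The types
    4+2+1 and 4+1+1+1, of sizes 630 and 210, give the same monomial, so 15 classes yield 14
    terms. *)
Lemma S7_cycle_lengths :
  [seq (tally (sort leq (map size (word_cycles 7 3 b.1))), b.2)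
     | b <- tally [seq cycle_type l | l <- S7]] =
  [:: ([:: (2, 1); (3, 1); (6, 5)], 840);
     ([:: (1, 1); (2, 3); (4, 7)], 630);
     ([:: (1, 2); (3, 11)], 280);
     ([:: (5, 7)], 504);
     ([:: (1, 3); (2, 1); (3, 4); (6, 3)], 420);
     ([:: (1, 1); (2, 3); (4, 7)], 210);
     ([:: (1, 5); (3, 10)], 70);
     ([:: (1, 7); (2, 14)], 105);
     ([:: (1, 15); (2, 10)], 21);
     ([:: (1, 3); (2, 16)], 105);
     ([:: (1, 35)], 1);
     ([:: (7, 5)], 720);
     ([:: (5, 3); (10, 2)], 504);
     ([:: (1, 1); (4, 1); (6, 1); (12, 2)], 420);
     ([:: (1, 1); (2, 2); (3, 2); (6, 4)], 210)]%N.
Proof. by vm_compute. Qed.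

Lemma big_tally (R : Type) (idx : R) (op : Monoid.com_law idx) (I : eqType)
    (s : seq I) (F : I -> R) :
  \big[op/idx]_(i <- s) F i =
  \big[op/idx]_(b <- tally s) iter b.2 (op (F b.1)) idx.
Proof.
rewrite -(perm_big _ (tallyK s)) /= big_flatten big_map.
by apply: eq_bigr => b _; rewrite big_nseq.
Qed.

Lemma prod_porbits_S7 (s : 'S_7) :
  \prod_(c in porbits (rperm 3 s^-1)) a #|c| =
  \prod_(c <- word_cycles 7 3 (cycle_type (oneline s))) a (size c).
Proof.
have sS7 : oneline s \in S7 by rewrite mem_permutations perm_oneline.
have /andP[] := allP S7_standardizes _ sS7.
rewrite size_map size_enum_ord => wp /eqP swt.
have /(allP S7_word_cycles_ok)/and4P[tp fM M0 pM] :
    cycle_type (oneline s) \in unzip1 (tally [seq cycle_type l | l <- S7]).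
  by rewrite (perm_mem (tallyEl _)) mem_undup map_f.
by apply: prod_porbits_rperm wp tp swt _ fM M0 pM; vm_compute.
Qed.

Theorem mainTheorem3 :
  cycle_index (rgroup 7 3) =
  ((7`!)%:R : rat)^-1 *:
    (a 1 ^+ 35 + 21 * a 1 ^+ 15 * a 2 ^+ 10 + 105 * a 1 ^+ 7 * a 2 ^+ 14
     + 70 * a 1 ^+ 5 * a 3 ^+ 10 + 105 * a 1 ^+ 3 * a 2 ^+ 16
     + 420 * a 1 ^+ 3 * a 2 * a 3 ^+ 4 * a 6 ^+ 3
     + 280 * a 1 ^+ 2 * a 3 ^+ 11
     + 420 * a 1 * a 4 * a 6 * a 12 ^+ 2
     + 840 * a 1 * a 2 ^+ 3 * a 4 ^+ 7
     + 210 * a 1 * a 2 ^+ 2 * a 3 ^+ 2 * a 6 ^+ 4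
     + 504 * a 5 ^+ 3 * a 10 ^+ 2 + 840 * a 2 * a 3 * a 6 ^+ 5
     + 504 * a 5 ^+ 7 + 720 * a 7 ^+ 5).
Proof.
rewrite (@cycle_index_rgroup 7 3 isT).
apply: (congr1 (fun u => _ *: u)).
pose F l : cpoly := \prod_(c <- word_cycles 7 3 (cycle_type l)) a (size c).
transitivity (\sum_(s : 'S_7) F (oneline s)).
  by apply: eq_bigr => s _; rewrite prod_porbits_S7.
rewrite sum_oneline -/S7.
pose G (e : seq (nat * nat)) : cpoly := \prod_(b <- e) a b.1 ^+ b.2.
have FG l : F l = G (tally (sort leq (map size (word_cycles 7 3 (cycle_type l))))).
  rewrite /F -(big_map size xpredT) -(perm_big _ (permEl (perm_sort leq _))) big_tally.
  by apply: eq_bigr => b _; rewrite iter_mulr_1.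
rewrite (eq_bigr _ (fun l _ => FG l)).
(* Grouping by cycle type leaves one term per class, with the class size as multiplicity. *)
rewrite -(big_map cycle_type xpredT
  (fun mu => G (tally (sort leq (map size (word_cycles 7 3 mu)))))) big_tally.
under eq_bigr do rewrite iter_addr_0.
rewrite -(big_map (fun b => (tally (sort leq (map size (word_cycles 7 3 b.1))), b.2))
  xpredT (fun q => G q.1 *+ q.2)) S7_cycle_lengths.
rewrite /G !big_cons !big_nil /=.
(* With the variables generalized to arbitrary elements, a commutative ring identity remains. *)
move: (a 1) (a 2) (a 3) (a 4) (a 5) (a 6) (a 7) (a 10) (a 12).
by move=> *; ring.
Qed.
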